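(* Let $R$ and $T$ be non-trivial transitive permutation groups, let $m$ be the degree of $R$ and let $T_\omega$ be a point-stabiliser in $T$. Then the imprimitive wreath product $R\wr T$ is $f$-graph-unrestrictive, where $f(n)=\frac{|T_\omega|^2|R|^{n/m}}{m^2}$. In particular, $R\wr T$ has graph-type $\mathrm{Exp}$.
   Context: All graphs are finite, simple and connected. For a graph $\Gamma$, a vertex $v$ and $G\le \mathrm{Aut}(\Gamma)$, $G_v^{\Gamma(v)}$ is the permutation group induced by $G_v$ on the neighbourhood $\Gamma(v)$. A pair $(\Gamma,G)$ with $G\le\mathrm{Aut}(\Gamma)$ is locally-$L$ if $G$ is transitive on the arcs of $\Gamma$ and $G_v^{\Gamma(v)}$ is permutation isomorphic to $L$. For $f:\mathbb N\to\mathbb R$, a transitive permutation group $L$ is $f$-graph-restrictive if $|G_{uv}|\le f(|\mathrm V(\Gamma)|)$ for every locally-$L$ pair $(\Gamma,G)$ and arc $(u,v)$; it is $f$-graph-unrestrictive if for every integer $n$ there is a locally-$L$ pair $(\Gamma,G)$ with $|\mathrm V(\Gamma)|\ge n$ and $|G_{uv}|\ge f(|\mathrm V(\Gamma)|)$ for an arc $(u,v)$. For a class $\mathcal C$ of functions, $L$ is $\mathcal C$-graph-(un)restrictive if it is $f$-graph-(un)restrictive for some $f\in\mathcal C$, and $L$ has graph-type $\mathcal C$ if it is both. $\mathrm{Exp}$ is the class of functions $f(n)=\alpha^n$ with $\alpha>1$. The imprimitive wreath product $R\wr T$ ($R$ on $\Delta$, $T$ on $\Omega=\{1,\dots,k\}$)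 is $R^k\rtimes T$ acting on $\Delta\times\Omega$ by $(\delta,\omega)^{(a_1,\dots,a_k)}=(\delta^{a_\omega},\omega)$ and $(\delta,\omega)^b=(\delta,\omega^b)$. *)

(* Defs.v *)
From mathcomp Require Import all_boot all_order all_algebra all_fingroup.
From mathcomp Require Import reals exp.

Set Implicit Arguments.
Unset Strict Implicit.
Unset Printing Implicit Defensive.

Import Order.TTheory GRing.Theory Num.Theory GroupScope.

Record graph := Graph {
  vertex :> finType;
  adj : rel vertex;
  adj_sym : symmetric adj;
  adj_irr : irreflexive adj;
  vertex_gt0 : 0 < #|vertex|;
  adj_conn : forall x y, connect adj x y
}.

Definition nbhd (X : graph) (v : X) : pred X := fun x => adj v x.

Definition autg (X : graph) : {set {perm X}} :=
  [set s : {perm X} | [forall x, forall y, adj (s x) (s y) == adj x y]].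

Lemma autgP (X : graph) (s : {perm X}) :
  reflect (forall x y, adj (s x) (s y) = adj x y) (s \in autg X).
Proof.
rewrite inE; apply: (iffP forallP) => [h x y|h x].
  by apply/eqP; have /forallP := h x; apply.
by apply/forallP => y; rewrite h.
Qed.

Lemma autg_group_set (X : graph) : group_set (autg X).
Proof.
apply/group_setP; split=> [|s t /autgP hs /autgP ht]; apply/autgP => x y.
  by rewrite !perm1.
by rewrite !permM ht hs.
Qed.

Canonical autg_group (X : graph) := Group (autg_group_set X).

Definition arc_transitive (X : graph) (G : {group {perm X}}) : Prop :=
  forall u v u' v' : X, adj u v -> adj u' v' ->
    exists2 g : {perm X}, g \in G & g u = u' /\ g v = v'.

(* The group G_v^{Gamma(v)}, as a group of permutations of the subtype of
   neighbours of v. The domain of the subaction consists of the permutations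
   stabilising the neighbourhood of v setwise; it contains G_v as soon as
   G \subset autg X, see local_groupP. *)
Definition local_group (X : graph) (G : {group {perm X}}) (v : X) :
    {group {perm {x | nbhd v x}}} :=
  (actperm (subaction {x | nbhd v x} 'P) @* 'C_G[v | 'P])%G.

Lemma stab_sub_dom (X : graph) (G : {group {perm X}}) (v : X) :
  G \subset autg X -> 'C_G[v | 'P] \subset subact_dom (nbhd v) 'P.
Proof.
move=> /subsetP sGA; apply/subsetP => s /setIP[/sGA /autgP sA /astab1P sv].
rewrite /= /aperm in sv; apply/astabsP => x.
by rewrite !inE /= /nbhd /aperm -{1}sv sA.
Qed.

Lemma local_groupP (X : graph) (G : {group {perm X}}) (v : X)
    (s : {perm {x | nbhd v x}}) :
  G \subset autg X ->
  reflect (exists2 g : {perm X}, g \in 'C_G[v | 'P]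
             & forall x, val (s x) = g (val x))
          (s \in local_group G v).
Proof.
move=> /(stab_sub_dom v)/subsetP sD.
apply: (iffP idP) => [/morphimP[g gD gG ->]|[g gG sg]].
  by exists g => // x; rewrite permE /= val_subact gD.
apply/morphimP; exists g => //; first exact: sD.
by apply/permP => x; apply: val_inj; rewrite sg permE /= val_subact sD.
Qed.

Definition perm_isomorphic (A B : finType)
    (H : {group {perm A}}) (L : {group {perm B}}) : Prop :=
  exists (phi : A -> B) (psi : {morphism H >-> {perm B}}),
    [/\ bijective phi, isom H L psi
      & forall h x, h \in H -> phi (h x) = psi h (phi x)].

Definition locally (B : finType) (L : {group {perm B}})
    (X : graph) (G : {group {perm X}}) : Prop :=
  [/\ G \subset autg X, arc_transitive G
    & forall v : X, perm_isomorphic (local_group G v) L].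

Section GraphType.
Local Open Scope ring_scope.
Variables (K : realType) (B : finType).

Definition graph_restrictive (f : nat -> K) (L : {group {perm B}}) : Prop :=
  forall (X : graph) (G : {group {perm X}}), locally L G ->
  forall u v : X, adj u v -> #|'C_G([set u; v] | 'P)|%:R <= f #|X|.

Definition graph_unrestrictive (f : nat -> K) (L : {group {perm B}}) : Prop :=
  forall n : nat, exists (X : graph) (G : {group {perm X}}),
    [/\ locally L G, (n <= #|X|)%N
      & exists u v : X, adj u v /\ f #|X| <= #|'C_G([set u; v] | 'P)|%:R].

Definition has_graph_type (C : (nat -> K) -> Prop) (L : {group {perm B}}) :
    Prop :=
  (exists2 f, C f & graph_restrictive f L) /\
  (exists2 f, C f & graph_unrestrictive f L).

End GraphType.

Definition Exp (K : realType) (f : nat -> K) : Prop :=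
  exists2 a : K, (1 < a)%R & forall n, f n = (a ^+ n)%R.

Section Wreath.
Variables Delta Omega : finType.

Definition base_fun (a : {ffun Omega -> {perm Delta}}) (p : Delta * Omega) :=
  (a p.2 p.1, p.2).

Lemma base_fun_inj a : injective (base_fun a).
Proof. by case=> x w [y w'] [] /= h e; move: h; rewrite e => /perm_inj ->. Qed.

Definition base_perm a : {perm Delta * Omega} := perm (@base_fun_inj a).

Definition top_fun (b : {perm Omega}) (p : Delta * Omega) := (p.1, b p.2).

Lemma top_fun_inj b : injective (top_fun b).
Proof. by case=> x w [y w'] [] /= -> /perm_inj ->. Qed.

Definition top_perm b : {perm Delta * Omega} := perm (@top_fun_inj b).

Variables (R : {group {perm Delta}}) (T : {group {perm Omega}}).

Definition wr_base : {set {perm Delta * Omega}} :=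
  [set base_perm a | a : {ffun Omega -> {perm Delta}} in ffun_on (mem R)].

Definition wr_top : {set {perm Delta * Omega}} := top_perm @: T.

Lemma wr_base_group_set : group_set wr_base.
Proof.
apply/group_setP; split.
  apply/imsetP; exists [ffun=> 1]; first by apply/ffun_onP => w; rewrite ffunE.
  by apply/permP => -[x w]; rewrite !permE /base_fun ffunE perm1.
move=> _ _ /imsetP[a /ffun_onP aR ->] /imsetP[b /ffun_onP bR ->].
apply/imsetP; exists [ffun w => a w * b w].
  by apply/ffun_onP => w; rewrite ffunE; apply: groupM; [exact: aR|exact: bR].
by apply/permP => -[x w]; rewrite permM !permE /base_fun /= ffunE permM.
Qed.
Canonical wr_base_group := Group wr_base_group_set.

Lemma wr_top_group_set : group_set wr_top.
Proof.
apply/group_setP; split.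
  apply/imsetP; exists 1 => //.
  by apply/permP => -[x w]; rewrite !permE /top_fun perm1.
move=> _ _ /imsetP[a aT ->] /imsetP[b bT ->].
apply/imsetP; exists (a * b); first exact: groupM.
by apply/permP => -[x w]; rewrite permM !permE /top_fun /= permM.
Qed.
Canonical wr_top_group := Group wr_top_group_set.

Definition wreath : {group {perm Delta * Omega}} := (wr_base <*> wr_top)%G.

Lemma wreath_sdprod : wr_base ><| wr_top = wreath.
Proof.
rewrite sdprodEY //.
  apply/subsetP => _ /imsetP[b bT ->].
  rewrite inE; apply/subsetP => _ /imsetP[_ /imsetP[a /ffun_onP aR ->] ->].
  apply/imsetP; exists [ffun w => a (b^-1 w)].
    by apply/ffun_onP => w; rewrite ffunE; exact: aR.
  apply/permP => -[x w]; rewrite -[w](permKV b); set w' := b^-1 w.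
  have -> : (x, b w') = top_perm b (x, w') by rewrite permE.
  by rewrite permJ !permE /base_fun /top_fun /= ffunE permK.
apply/trivgP/subsetP => _ /setIP[/imsetP[a aR ->] /imsetP[b bT]] E.
rewrite inE; apply/eqP/permP => -[x w].
have := congr1 (fun s : {perm _} => (s (x, w)).1) E.
have := congr1 (fun s : {perm _} => (s (x, w)).2) E.
by rewrite !permE /base_fun /top_fun /= => _ ->.
Qed.

Lemma wreathP (s : {perm Delta * Omega}) :
  reflect (exists (a : {ffun Omega -> {perm Delta}}) (b : {perm Omega}),
             [/\ forall w, a w \in R, b \in T
               & forall x w, s (x, w) = (a w x, b w)])
          (s \in wreath).
Proof.
have [_ /= <- _ _] := sdprodP wreath_sdprod.
apply: (iffP mulsgP) => [[_ _ /imsetP[a /ffun_onP aR ->] /imsetP[b bT ->] ->]|].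
  by exists a, b; split=> // x w; rewrite permM !permE.
move=> [a [b [aR bT sE]]]; exists (base_perm a) (top_perm b).
- by apply/imsetP; exists a => //; apply/ffun_onP.
- by apply/imsetP; exists b.
- by apply/permP => -[x w]; rewrite permM sE !permE.
Qed.

Lemma wreath_trans :
  [transitive R, on [set: Delta] | 'P] ->
  [transitive T, on [set: Omega] | 'P] ->
  [transitive wreath, on [set: Delta * Omega] | 'P].
Proof.
move=> tR tT; have [x0 _ _] := imsetP tR; have [w0 _ _] := imsetP tT.
apply/imsetP; exists (x0, w0); rewrite ?inE //.
apply/esym/setP => -[x w]; rewrite inE; apply/orbitP.
have [r rR rx] := atransP2 tR (in_setT x0) (in_setT x).
have [t tT' tw] := atransP2 tT (in_setT w0) (in_setT w).
exists (base_perm [ffun=> r] * top_perm t).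
  apply/wreathP; exists [ffun=> r], t; split=> // [z|y z]; rewrite ?ffunE //.
  by rewrite permM !permE /base_fun /top_fun /= ffunE.
by rewrite /= /aperm permM !permE /base_fun /top_fun /= ffunE rx tw.
Qed.

End Wreath.

(* Main.v *)
Require Import Defs.
From mathcomp Require Import all_boot all_order all_algebra all_fingroup.
From mathcomp Require Import reals exp.

(**
  Unrestrictiveness.  The complete bipartite graph on two copies of Omega has
  local group T under the wreath product of T by Z/2, and the stabiliser of an
  edge contains T_w x T_w.  Its homology covers modulo n are arbitrarily large
  and the whole group lifts to them, so there are arbitrarily large graphs X
  with local group T and arc-stabiliser of order at least |T_w|^2.  Blowing up
  every vertex of X to a copy of Delta yields a graph on m|X| vertices with
  local group R wr T; its arc-stabiliser contains the elements of R^X fixing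
  one point in each of two blocks, which gives the factor |R|^|X| / m^2.

  At each stage the group is taken to be the universal group of all
  permutations that act locally through the prescribed group, with respect to
  a fixed labelling of the neighbourhoods: the local group is then bounded
  from above by construction, and only enough elements must be exhibited.

  Restrictiveness.  In a connected graph of valency d, extending a set of
  fixed vertices by an adjacent vertex divides the order of the pointwise
  stabiliser by at most d, so |G_uv| <= d^|V|.
*)

Set Implicit Arguments.
Unset Strict Implicit.
Unset Printing Implicit Defensive.

Import Order.TTheory GRing.Theory Num.Theory GroupScope.

(** The isomorphism is conjugation by [phi], so matching the two actions element by element
    suffices. *)
Lemma perm_isomorphic_bij (A B : finType) (H : {group {perm A}})
    (L : {group {perm B}}) (phi : A -> B) :
    bijective phi ->
    (forall h, h \in H -> exists2 l, l \in L & forall x, phi (h x) = l (phi x)) ->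
    (forall l, l \in L -> exists2 h, h \in H & forall x, phi (h x) = l (phi x)) ->
  perm_isomorphic H L.
Proof.
move=> bij_phi HL LH; have [phi' phiK phi'K] := bij_phi.
have inj h : injective (fun b => phi ((h : {perm A}) (phi' b))).
  by move=> b c /(can_inj phiK)/perm_inj/(can_inj phi'K).
pose psi h : {perm B} := perm (inj h).
have psiD h b : psi h b = phi (h (phi' b)) by rewrite permE.
have psiM : {in H &, {morph psi : h k / h * k}}.
  by move=> h k _ _; apply/permP => b; rewrite permM !psiD phiK permM.
have psiE (h : {perm A}) x : phi (h x) = psi h (phi x) by rewrite psiD phiK.
exists phi, (Morphism psiM); split=> [//||h x _]; last exact: psiE.
apply/isomP; split.
  apply/injmP => h k _ _ /= e; apply/permP => x.
  by apply: (can_inj phiK); have /permP/(_ (phi x)) := e; rewrite !psiD phiK.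
apply/setP => l; rewrite /= morphimEdom; apply/imsetP/idP.
  move=> [h /HL[k kL kE] ->]; suff e : psi h = k by rewrite -e in kL.
  by apply/permP => b; rewrite -[b]phi'K -psiE kE.
move=> /LH[h hH hE]; exists h => //.
by apply/permP => b; rewrite -[b]phi'K -psiE hE.
Qed.

(** * Connected graphs of bounded valency *)

(** Otherwise [S] would be closed under adjacency, hence a union of connected components. *)
Lemma connected_boundary (X : graph) (S : {set X}) :
    S != set0 -> S != setT ->
  exists s x, [/\ s \in S, x \notin S & adj s x].
Proof.
move=> /set0Pn[s sS] ST.
have /existsP[y yS] : [exists y, y \notin S].
  rewrite -negb_forall; apply: contra ST => /forallP SA.
  by apply/eqP/setP => y; rewrite inE SA.
have [/existsP[a /existsP[b /and3P[aS bS ab]]]|/existsPn no] :=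
    boolP [exists a, exists b, [&& a \in S, b \notin S & adj a b]].
  by exists a, b.
have cl a b : adj a b -> a \in S -> b \in S.
  move=> ab aS; apply: contraT => bS.
  by have /existsPn/(_ b) := no a; rewrite aS bS ab.
have cS : closed (@adj X) (mem S).
  by move=> a b ab; apply/idP/idP; apply: cl; rewrite // adj_sym.
by have := closed_connect cS (adj_conn s y); rewrite sS (negPf yS).
Qed.

(* Fixing one more vertex, adjacent to a fixed one, costs a factor of at
   most the valency. *)
Lemma card_pointwise_stab (X : graph) (G : {group {perm X}}) (d : nat) :
    G \subset autg X -> (forall v : X, #|nbhd v| <= d) ->
  forall S : {set X}, S != set0 -> #|'C_G(S | 'P)| <= d ^ #|~: S|.
Proof.
move=> /subsetP sGA val_d S; move: {2}#|~: S| (erefl #|~: S|) => k.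
elim: k S => [|k IHk] S kE S0.
  have -> : S = setT.
    by apply: (can_inj (@setCK _)); rewrite setCT; exact: cards0_eq.
  rewrite setCT cards0 expn0.
  have /subset_leq_card : 'C_G(setT | 'P) \subset [set 1].
    apply/subsetP => g /setIP[_ /astabP gE]; rewrite inE; apply/eqP/permP => x.
    by rewrite perm1 -[RHS](gE x) // inE.
  by rewrite cards1.
have ST : S != setT by apply: contra_eqN kE => /eqP ->; rewrite setCT cards0.
have [s [x [sS xS sx]]] := connected_boundary S0 ST.
have CE : ~: S = x |: ~: (x |: S).
  by apply/setP => y; rewrite !inE; case: eqP => [->|].
have kE' : #|~: (x |: S)| = k.
  by move: kE; rewrite CE cardsU1 !inE eqxx /= add1n => -[].
have := IHk (x |: S) kE'; rewrite kE' kE expnS => IH.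
(* The group fixes [s], so the orbit of [x] stays among the neighbours of [s]. *)
rewrite -(card_orbit_stab 'P _ x) leq_mul //.
  apply: leq_trans (val_d s); apply/subset_leq_card/subsetP => y /orbitP[g].
  case/setIP=> /sGA/autgP gA /astabP/(_ s sS) /= gs <-.
  by rewrite unfold_in /nbhd -[s in adj s _]gs gA.
apply: leq_trans (IH _); last by apply/set0Pn; exists x; rewrite !inE eqxx.
apply/subset_leq_card/subsetP => g /setIP[/setIP[gG /astabP gS] /astab1P gx].
by rewrite inE gG; apply/astabP => y /setU1P[->//|/gS].
Qed.

Lemma card_nbhd_locally (B : finType) (L : {group {perm B}}) (X : graph)
    (G : {group {perm X}}) (v : X) :
  locally L G -> #|nbhd v| = #|B|.
Proof.
case=> _ _ /(_ v)[phi [_ [bij_phi _ _]]].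
by rewrite -(bij_eq_card bij_phi) card_sig.
Qed.

Lemma card_arc_stab (B : finType) (L : {group {perm B}}) (X : graph)
    (G : {group {perm X}}) (u v : X) :
  0 < #|B| -> locally L G -> #|'C_G([set u; v] | 'P)| <= #|B| ^ #|X|.
Proof.
move=> B0 locG; have [sGA _ _] := locG.
apply: leq_trans (card_pointwise_stab sGA (d := #|B|) _ _) _.
- by move=> x; rewrite (card_nbhd_locally x locG).
- by apply/set0Pn; exists u; rewrite !inE eqxx.
- by rewrite leq_pexp2l // max_card.
Qed.

(** * Graphs with labelled neighbourhoods and their universal groups *)

(** The labels at the two ends of an edge are unrelated. Connectedness is only demanded in
    [graph_of], since a cover may be disconnected. *)
Record lgraph (B : finType) := LGraph {
  lvertex :> finType;
  nb : lvertex -> B -> lvertex;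
  nb_inj : forall x, injective (nb x);
  nb_irr : forall x b, nb x b != x;
  nb_sym : forall x b, exists c, nb (nb x b) c = x
}.

Section UniversalGroup.
Variables (B : finType) (X : lgraph B).
Implicit Types (x y : X) (L : {group {perm B}}).

Definition ladj : rel X := fun x y => [exists b, nb x b == y].

Lemma ladjP x y : reflect (exists b, nb x b = y) (ladj x y).
Proof. exact: 'exists_eqP. Qed.

Lemma ladj_nb x b : ladj x (nb x b).
Proof. by apply/ladjP; exists b. Qed.

Lemma ladj_sym : symmetric ladj.
Proof.
suff imp x y : ladj x y -> ladj y x by move=> x y; apply/idP/idP; exact: imp.
by case/ladjP=> b <-; apply/ladjP; exact: nb_sym.
Qed.

Lemma ladj_irr : irreflexive ladj.
Proof. by move=> x; apply/ladjP => -[b /eqP]; rewrite (negPf (nb_irr x b)). Qed.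

Lemma lvertex_gt0 x : 0 < #|X|.
Proof. by apply/card_gt0P; exists x. Qed.

Definition graph_of x (conn : forall y z : X, connect ladj y z) : graph :=
  Graph ladj_sym ladj_irr (lvertex_gt0 x) conn.

(* The finite analogue of the Burger-Mozes universal group: the permutations
   acting at every vertex, read through the labels, as an element of L. *)
Definition ugroup L : {set {perm X}} :=
  [set g : {perm X} |
    [forall x, exists l in L, forall b, g (nb x b) == nb (g x) (l b)]].

Lemma ugroupP L (g : {perm X}) :
  reflect (forall x, exists2 l, l \in L & forall b, g (nb x b) = nb (g x) (l b))
          (g \in ugroup L).
Proof.
rewrite inE; apply: (iffP forallP) => gL x.
  by have /exists_inP[l lL /'forall_eqP lE] := gL x; exists l.
by have [l lL lE] := gL x; apply/exists_inP; exists l => //; apply/'forall_eqP.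
Qed.

Lemma ugroup_group_set L : group_set (ugroup L).
Proof.
apply/group_setP; split=> [|g h /ugroupP gL /ugroupP hL]; apply/ugroupP => x.
  by exists 1 => // b; rewrite !perm1.
have [l lL lE] := gL x; have [k kL kE] := hL (g x).
by exists (l * k); rewrite ?groupM // => b; rewrite !permM lE kE.
Qed.
Canonical ugroup_group L := Group (ugroup_group_set L).

Lemma ladj_ugroup L (g : {perm X}) x y :
  g \in ugroup L -> ladj (g x) (g y) = ladj x y.
Proof.
move=> /ugroupP/(_ x)[l _ lE]; apply/ladjP/ladjP => -[b].
  by rewrite -[b](permKV l) -lE => /perm_inj <-; eexists.
by move=> <-; exists (l b); rewrite lE.
Qed.

(** Local groups lie in [L] by definition of [ugroup]; equality at [x0] spreads by
    vertex-transitivity, and transitivity of [L] on the labels gives arc-transitivity. *)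
Lemma ugroup_locally L x0 (conn : forall y z : X, connect ladj y z) :
    [transitive L, on [set: B] | 'P] ->
    (forall x, exists2 g, g \in ugroup L & g x0 = x) ->
    (forall l, l \in L -> exists2 g, g \in ugroup L &
       g x0 = x0 /\ forall b, g (nb x0 b) = nb x0 (l b)) ->
  @locally B L (graph_of x0 conn) (ugroup_group L).
Proof.
move=> trL trU real0.
have real x l : l \in L -> exists2 g, g \in ugroup L &
    g x = x /\ forall b, g (nb x b) = nb x (l b).
  move=> lL; have [g gU gx] := trU x.
  have [k kL kE] := ugroupP _ _ gU x0; rewrite gx in kE.
  (* As [g] acts by [k] at [x0], conjugation by [g] turns [k * l * k^-1] at [x0] into [l] at [x]. *)
  have [|h hU [hx hE]] := real0 (k * l * k^-1); first by rewrite !groupM ?groupV.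
  exists (h ^ g); first exact: groupJ.
  split=> [|b]; first by rewrite -[in LHS]gx permJ hx.
  rewrite -[in LHS](permKV k b) -kE permJ hE !permM permKV kE.
  by rewrite permKV.
pose Y := graph_of x0 conn; pose U : {group {perm Y}} := ugroup_group L.
have sUA : U \subset autg Y.
  by apply/subsetP => g gU; apply/autgP => x y; exact: ladj_ugroup gU.
split=> // [u v u' v' /ladjP[b <-] /ladjP[b' <-]|v].
  have [g gU gu] := trU u; have [g' gU' gu'] := trU u'.
  have hU : g^-1 * g' \in ugroup L by rewrite groupM ?groupV.
  have hu : (g^-1 * g') u = u' by rewrite permM -gu permK.
  have [l lL lE] := ugroupP _ _ hU u.
  (* The tail is now at [u']; an element fixing [u'] corrects the head. *)
  have [k kL kE] := atransP2 trL (in_setT (l b)) (in_setT b').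
  have [h hU' [hx hE]] := real u' _ kL.
  exists (g^-1 * g' * h); first by rewrite groupM.
  by rewrite !(permM (g^-1 * g')) lE hu hx hE kE.
pose phi (z : {x | @nbhd Y v x}) : B :=
  xchoose (existsP (valP z)).
have phiE z : nb v (phi z) = val z := eqP (xchooseP (existsP (valP z))).
pose phi' b : {x | @nbhd Y v x} := Sub (nb v b) (ladj_nb v b).
have bij : bijective phi.
  exists phi' => [z|b]; first by apply: val_inj; rewrite /= phiE.
  by apply: (@nb_inj _ _ v); rewrite phiE.
apply: (perm_isomorphic_bij bij) => [h|l].
  move/(local_groupP _ sUA)=> [g /setIP[gU /astab1P gv] gE].
  have [l lL lE] := ugroupP _ _ gU v; exists l => // z.
  by apply: (@nb_inj _ _ v); rewrite phiE gE -phiE lE [g v]gv.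
move=> lL; have [g gU [gv gE]] := real v l lL.
have gC : g \in 'C_U[v | 'P] by rewrite inE gU; apply/astab1P.
have gD := subsetP (stab_sub_dom v sUA) _ gC.
have hE z : val (actperm (subaction {x | @nbhd Y v x} 'P) g z)
    = g (val z) by rewrite permE /= val_subact gD.
exists (actperm (subaction {x | @nbhd Y v x} 'P) g).
  by apply/(local_groupP _ sUA); exists g.
by move=> z; apply: (@nb_inj _ _ v); rewrite phiE hE -phiE gE.
Qed.

End UniversalGroup.

Arguments ugroup {B} X L.
Arguments ladj {B} X.

(** * Connected components of labelled graphs *)

Section Component.
Variables (B : finType) (X : lgraph B) (x0 : X).

Let C := {x | connect (ladj X) x0 x}.

Lemma component_nb_subproof (x : C) b : connect (ladj X) x0 (nb (val x) b).
Proof. exact: connect_trans (valP x) (connect1 (ladj_nb _ _)). Qed.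

Definition component_nb (x : C) b : C := Sub _ (component_nb_subproof x b).

Lemma component_nb_inj x : injective (component_nb x).
Proof. by move=> b c /(congr1 val)/nb_inj. Qed.

Lemma component_nb_irr x b : component_nb x b != x.
Proof. exact: nb_irr. Qed.

Lemma component_nb_sym x b : exists c, component_nb (component_nb x b) c = x.
Proof. by have [c cE] := nb_sym (val x) b; exists c; apply: val_inj. Qed.

Definition component :=
  LGraph component_nb_inj component_nb_irr component_nb_sym.

Definition component_root : component := Sub x0 (connect0 _ x0).


Lemma component_connected (x y : component) : connect (ladj component) x y.
Proof.
suff root z : connect (ladj component) component_root z.
  apply: connect_trans (root y).
  by rewrite (sym_connect_sym (@ladj_sym _ component)).
case: z => z x0z; case/connectP: (x0z) => p.
elim/last_ind: p z x0z => [|p y' IHp] z x0z.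
  move=> /= _ zE; subst z.
  by rewrite (bool_irrelevance x0z (connect0 _ x0)) connect0.
rewrite rcons_path last_rcons => /andP[px0 py'] zE; subst z.
have x0p : connect (ladj X) x0 (last x0 p) by apply/connectP; exists p.
apply: connect_trans (IHp _ x0p px0 erefl) (connect1 _).
by have /ladjP[b bE] := py'; apply/ladjP; exists b; apply: val_inj.
Qed.

(** The restriction of [g] if [g] preserves the component; otherwise [subaction] makes it the
    identity. *)
Definition component_perm (g : {perm X}) : {perm component} :=
  actperm (subaction C 'P) g.

Section ComponentPerm.
Variables (L : {group {perm B}}) (g : {perm X}).
Hypotheses (gL : g \in ugroup X L) (gx0 : connect (ladj X) x0 (g x0)).

(** Automorphisms permute the components, so one that keeps [x0] in its component preserves that
    component. *)
Lemma component_permE (x : component) : val (component_perm g x) = g (val x).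
Proof.
have gC z : connect (ladj X) (g x0) (g z) = connect (ladj X) x0 z.
  have imp a b h : h \in ugroup X L ->
      connect (ladj X) a b -> connect (ladj X) (h a) (h b).
    move=> hL /connectP[p pa ->]; elim: p a pa => //= c p IHp a /andP[ac pc].
    apply: connect_trans (IHp c pc); apply: connect1.
    by rewrite (ladj_ugroup _ _ hL).
  apply/idP/idP; last exact: imp.
  by rewrite -{2}[x0](permK g) -{2}[z](permK g); apply: imp; rewrite groupV.
rewrite permE /= val_subact ifT //; apply/astabsP => z.
rewrite !inE /= /aperm -(gC z).
by apply: (same_connect (sym_connect_sym (@ladj_sym _ X))).
Qed.

Lemma component_perm_ugroup : component_perm g \in ugroup component L.
Proof.
apply/ugroupP => x; have [l lL lE] := ugroupP _ _ gL (val x).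
by exists l => // b; apply: val_inj; rewrite component_permE /= component_permE.
Qed.

End ComponentPerm.
End Component.

(** * The homology cover modulo [n + 2] *)

Section Cover.
Variables (B : finType) (X : lgraph B) (n : nat).

Let M := {ffun X * X -> 'I_n.+2}.

(** The 1-chain of the arc from [u] to [v], used as its voltage; it is antisymmetric, so that
    walking back along an edge of the cover undoes the step. *)
Definition eps (u v : X) : M :=
  [ffun p => (p == (u, v))%:R - (p == (v, u))%:R]%R.

Lemma epsN u v : eps v u = (- eps u v)%R.
Proof. by apply/ffunP => p; rewrite !ffunE opprB. Qed.

Definition cover_nb (y : X * M) b : X * M :=
  (nb y.1 b, y.2 + eps y.1 (nb y.1 b))%R.

Lemma cover_nb_inj y : injective (cover_nb y).
Proof. by move=> b c [] /nb_inj. Qed.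

Lemma cover_nb_irr y b : cover_nb y b != y.
Proof. by apply: contraNneq (nb_irr y.1 b) => /(congr1 fst) /= ->. Qed.

Lemma cover_nb_sym y b : exists c, cover_nb (cover_nb y b) c = y.
Proof.
have [c cE] := nb_sym y.1 b; exists c.
by case: y cE => u x cE; rewrite /cover_nb /= cE (epsN u) addrK.
Qed.

Definition cover := LGraph cover_nb_inj cover_nb_irr cover_nb_sym.

(** Push-forward of chains along [s], hence the inverses. *)
Definition coef_act (s : {perm X}) (x : M) : M :=
  [ffun p => x (s^-1 p.1, s^-1 p.2)].

Lemma coef_act_inj s : injective (coef_act s).
Proof.
move=> x y /ffunP e; apply/ffunP => -[u v].
by have := e (s u, s v); rewrite !ffunE /= !permK.
Qed.

Lemma coef_actD s x y : coef_act s (x + y)%R = (coef_act s x + coef_act s y)%R.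
Proof. by apply/ffunP => p; rewrite !ffunE. Qed.

Lemma coef_act0 s : coef_act s 0%R = 0%R.
Proof. by apply/ffunP => p; rewrite !ffunE. Qed.

Lemma coef_act_eps s u v : coef_act s (eps u v) = eps (s u) (s v).
Proof.
have e p a b : ((s^-1 p.1, s^-1 p.2) == (a, b)) = (p == (s a, s b)).
  case: p => c d; rewrite !xpair_eqE /=.
  by rewrite !(canF_eq (permKV s)).
by apply/ffunP => p; rewrite !ffunE !e.
Qed.

Definition cover_fun (s : {perm X}) (t : M) (y : cover) : cover :=
  (s y.1, coef_act s y.2 + t)%R.

Lemma cover_fun_inj s t : injective (cover_fun s t).
Proof. by case=> u x [v y] [] /perm_inj -> /addIr/coef_act_inj ->. Qed.

Definition cover_perm s t : {perm cover} := perm (@cover_fun_inj s t).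

(** Since [eps] is equivariant, [s] lifts, and translations by [t] commute with adding voltages. The
    cover inherits the labels of [X], so the local action is unchanged. *)
Lemma cover_perm_ugroup (L : {group {perm B}}) s t :
  s \in ugroup X L -> cover_perm s t \in ugroup cover L.
Proof.
move/ugroupP=> sL; apply/ugroupP => -[u x]; have [l lL lE] := sL u.
exists l => // b; rewrite !permE /cover_fun /cover_nb /= lE; congr pair.
by rewrite coef_actD coef_act_eps lE addrAC.
Qed.

Lemma connect_step4 (a b a' b' : X) :
    ladj X a b -> ladj X b a' -> ladj X a' b' -> ladj X b' a ->
  forall x : M, connect (ladj cover) (a, x)
    (a, x + (eps a b + eps b a' + eps a' b' + eps b' a))%R.
Proof.
have step u v x : ladj X u v -> connect (ladj cover) (u, x) (v, x + eps u v)%R.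
  by case/ladjP=> c <-; apply/connect1/ladjP; exists c.
move=> ab ba' a'b' b'a x; rewrite !addrA.
do 3![apply: connect_trans; last exact: step].
exact: step.
Qed.

(* The voltage of a 4-cycle has order n + 2. *)
Lemma card_component_cover (a b a' b' : X) :
    ladj X a b -> ladj X b a' -> ladj X a' b' -> ladj X b' a ->
    a != a' -> b != b' ->
  n < #|component ((a, 0%R) : cover)|.
Proof.
move=> ab ba' a'b' b'a aa' bb'.
pose c := (eps a b + eps b a' + eps a' b' + eps b' a)%R.
(* Going [k] times round the 4-cycle returns to the fibre of [a], shifted by [c *+ k]. *)
have conn k : connect (ladj cover) (a, 0%R) (a, c *+ k)%R.
  elim: k => [|k IHk]; first by rewrite mulr0n connect0.
  by apply: connect_trans IHk _; rewrite mulrSr; exact: connect_step4.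
have nab : a != b by apply: contraTneq ab => ->; rewrite ladj_irr.
have nab' : a != b' by apply: contraTneq b'a => ->; rewrite ladj_irr.
(* Only the first arc of the cycle contributes at [(a, b)]; this coordinate separates the multiples
   of [c]. *)
have c1 : c (a, b) = 1%R.
  rewrite !ffunE !xpair_eqE !eqxx /= (negPf nab) (negPf nab') (negPf aa').
  by rewrite (negPf bb') /= !subr0 !addr0.
pose f (k : 'I_n.+2) : component ((a, 0%R) : cover) := Sub (a, c *+ k)%R (conn k).
have f_inj : injective f.
  move=> j k /(congr1 val)/(congr1 snd)/ffunP/(_ (a, b)).
  by rewrite !ffunMnE c1 !natr_Zp.
by have := leq_card f f_inj; rewrite card_ord => /ltnW.
Qed.

End Cover.

(** * The complete bipartite graph on two copies of [B] *)

Section CompleteBipartite.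
Variable B : finType.

Definition bip_nb (y : bool * B) b : bool * B := (~~ y.1, b).

Lemma bip_nb_inj y : injective (bip_nb y).
Proof. by move=> b c []. Qed.

Lemma bip_nb_irr y b : bip_nb y b != y.
Proof. by case: y => -[] c. Qed.

Lemma bip_nb_sym y b : exists c, bip_nb (bip_nb y b) c = y.
Proof. by case: y => c d; exists d; rewrite /bip_nb /= negbK. Qed.

Definition bipartite := LGraph bip_nb_inj bip_nb_irr bip_nb_sym.

Definition bip_fun c (s t : {perm B}) (y : bipartite) : bipartite :=
  (c (+) y.1, (if y.1 then s else t) y.2).

Lemma bip_fun_inj c s t : injective (bip_fun c s t).
Proof. by case=> d i [e j] [] /addbI -> /perm_inj ->. Qed.

Definition bip_perm c s t : {perm bipartite} := perm (@bip_fun_inj c s t).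

Lemma bip_perm_ugroup (L : {group {perm B}}) c s t :
  s \in L -> t \in L -> bip_perm c s t \in ugroup bipartite L.
Proof.
(* The neighbours of a vertex form the opposite side, so the local action is the permutation of that
   side. *)
move=> sL tL; apply/ugroupP => -[d i]; exists (if d then t else s).
  by case: d.
by move=> b; rewrite !permE /bip_fun /bip_nb /= addbN; case: d.
Qed.

End CompleteBipartite.

(** * Blow-ups: the lexicographic product with an edgeless graph on [Delta] *)

Section Lexicographic.
Variables (Delta Omega : finType) (X : lgraph Omega).

Definition lex_nb (y : Delta * X) (b : Delta * Omega) : Delta * X :=
  (b.1, nb y.2 b.2).

Lemma lex_nb_inj y : injective (lex_nb y).
Proof. by case=> d i [e j] [-> /nb_inj ->]. Qed.

Lemma lex_nb_irr y b : lex_nb y b != y.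
Proof. by apply: contraNneq (nb_irr y.2 b.2) => /(congr1 snd) /= ->. Qed.

Lemma lex_nb_sym y b : exists c, lex_nb (lex_nb y b) c = y.
Proof.
have [c cE] := nb_sym y.2 b.2; exists (y.1, c).
by rewrite /lex_nb /= cE; case: y {cE}.
Qed.

Definition lex := LGraph lex_nb_inj lex_nb_irr lex_nb_sym.

Lemma ladj_lex (y z : lex) : ladj lex y z = ladj X y.2 z.2.
Proof.
apply/ladjP/ladjP => [[b <-]|[j jE]]; first by exists b.2.
by exists (z.1, j); rewrite /= /lex_nb /= jE; case: z {jE}.
Qed.

(** Points of one block are joined through the block of a neighbour, which exists thanks to [w];
    then a path of [X] lifts with constant first coordinate. *)
Lemma lex_connected (w : Omega) :
    (forall x y, connect (ladj X) x y) ->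
  forall y z, connect (ladj lex) y z.
Proof.
move=> conn [d x] [e y].
apply: (@connect_trans _ _ (e, x)).
  apply: (@connect_trans _ _ (d, nb x w)); apply: connect1.
    by rewrite ladj_lex /= ladj_nb.
  by rewrite ladj_lex /= ladj_sym ladj_nb.
have /connectP[p px ->] := conn x y.
elim: p x px => [|z p IHp] x /=; first by rewrite connect0.
case/andP=> xz /IHp; apply: connect_trans.
by apply: connect1; rewrite ladj_lex.
Qed.

Definition lex_fun (r : {ffun X -> {perm Delta}}) (g : {perm X}) (y : lex) :
    lex :=
  (r y.2 y.1, g y.2).

Lemma lex_fun_inj r g : injective (lex_fun r g).
Proof.
by case=> d x [e y] [/= h /perm_inj xy]; move: h; rewrite xy => /perm_inj ->.
Qed.

Definition lex_perm r g : {perm lex} := perm (@lex_fun_inj r g).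

Lemma lex_permE r g d x : lex_perm r g (d, x) = (r x d, g x).
Proof. by rewrite permE. Qed.

Lemma lex_perm_inj (d : Delta) r g r' g' :
  lex_perm r g = lex_perm r' g' -> r = r' /\ g = g'.
Proof.
move/permP=> e; split.
  apply/ffunP => x; apply/permP => c.
  by have := e (c, x); rewrite !lex_permE => -[].
by apply/permP => x; have := e (d, x); rewrite !lex_permE => -[].
Qed.

Variables (R : {group {perm Delta}}) (T : {group {perm Omega}}).

(** Around [(d, x)] the neighbouring blocks are permuted as [g] permutes the neighbours of [x], and
    [r] acts inside each block. *)
Lemma lex_perm_ugroup (r : {ffun X -> {perm Delta}}) g :
    (forall x, r x \in R) -> g \in ugroup X T ->
  lex_perm r g \in ugroup lex (wreath R T).
Proof.
move=> rR /ugroupP gT; apply/ugroupP => -[d x]; have [t tT tE] := gT x.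
pose a := [ffun j => r (nb x j)].
have sE c j : (base_perm a * top_perm _ t) (c, j) = (r (nb x j) c, t j).
  by rewrite permM !permE /base_fun /top_fun /= ffunE.
exists (base_perm a * top_perm _ t).
  by apply/wreathP; exists a, t; split=> // [j|c j]; rewrite ?sE ffunE.
by case=> c j; rewrite sE /= /lex_nb !lex_permE /= tE.
Qed.

Lemma lex_locally (d0 : Delta) (x0 : X)
    (conn : forall y z, connect (ladj lex) y z) :
    [transitive R, on [set: Delta] | 'P] ->
    [transitive T, on [set: Omega] | 'P] ->
    (forall x, exists2 g, g \in ugroup X T & g x0 = x) ->
    (forall t, t \in T -> exists2 g, g \in ugroup X T &
       g x0 = x0 /\ forall j, g (nb x0 j) = nb x0 (t j)) ->
  @locally _ (wreath R T) (graph_of (X := lex) (d0, x0) conn)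
    (ugroup_group lex (wreath R T)).
Proof.
move=> trR trT trU real; apply: ugroup_locally.
- exact: wreath_trans.
- move=> [d x]; have [g gU gx] := trU x.
  have [r rR rd] := atransP2 trR (in_setT d0) (in_setT d).
  exists (lex_perm [ffun=> r] g).
    by apply: lex_perm_ugroup => // y; rewrite ffunE.
  by rewrite lex_permE ffunE gx rd.
move=> l /wreathP[a [t [aR tT lE]]]; have [g gU [gx gE]] := real t tT.
(* Put [a j] on the block with label [j] and the identity on all other blocks, including that of
   [x0], so that the root is fixed. *)
pose r := [ffun x => if [pick j | nb x0 j == x] is Some j then a j else 1].
have r0 : r x0 = 1.
  by rewrite ffunE; case: pickP => // j; rewrite (negPf (nb_irr x0 j)).
have rE j : r (nb x0 j) = a j.
  rewrite ffunE; case: pickP => [i /eqP/nb_inj -> //|/(_ j)].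
  by rewrite eqxx.
exists (lex_perm r g).
  by apply: lex_perm_ugroup => // x; rewrite ffunE; case: pickP.
split=> [|[d j]]; first by rewrite lex_permE r0 perm1 gx.
by rewrite /= /lex_nb /= lex_permE rE gE lE.
Qed.

(** Pairs [(r, g)] with [g] fixing [x] and [y], and [r x] and [r y] fixing [d0], embed in the
    stabiliser. Each of the two constraints on [r] costs a factor [#|Delta|], by
    orbit-stabiliser. *)
Lemma card_lex_arc_stab (d0 : Delta) (x y : X) :
    [transitive R, on [set: Delta] | 'P] -> x != y ->
  #|'C_(ugroup X T)([set x; y] | 'P)| * #|R| ^ #|X| <=
  #|Delta| ^ 2 *
    #|'C_(ugroup lex (wreath R T))([set ((d0, x) : lex); (d0, y)] | 'P)|.
Proof.
move=> trR xy; set C := 'C_(_)(_ | _); set D := 'C_(ugroup lex _)(_ | _).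
pose F z : {set {perm Delta}} :=
  if (z == x) || (z == y) then 'C_R[d0 | 'P] else R.
pose A : {set {ffun X -> {perm Delta}}} :=
  [set r in family (fun z => mem (F z))].
have RE : #|R| = (#|Delta| * #|'C_R[d0 | 'P]|)%N.
  by rewrite -(card_orbit_stab 'P R d0) (atransP trR d0) ?inE // cardsT.
have AE : (#|Delta| ^ 2 * #|A| = #|R| ^ #|X|)%N.
  have yx : y != x by rewrite eq_sym.
  have prodD2 (H : X -> nat) :
      (\prod_z H z = H x * (H y * \prod_(z | (z != x) && (z != y)) H z))%N.
    by rewrite (bigD1 x) //= (bigD1 y).
  rewrite cardsE card_family foldrE big_image /= -prod_nat_const !prodD2.
  rewrite /F !eqxx orbT /=.
  rewrite [in LHS](eq_bigr (fun=> #|R|)); last first.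
    by move=> z /andP[zx zy]; rewrite (negPf zx) (negPf zy).
  rewrite !mulnA; congr (_ * _)%N; rewrite RE -mulnn -!mulnA.
  by congr (_ * _)%N; rewrite mulnCA.
have sAD : [set lex_perm p.1 p.2 | p in setX A C] \subset D.
  apply/subsetP => _ /imsetP[[r g] /setXP[/= rA /setIP[gU /astabP gxy]] ->].
  have {}rA z : r z \in F z by move: rA; rewrite inE => /familyP/(_ z).
  rewrite inE lex_perm_ugroup //=; last first.
    by move=> z; have := rA z; rewrite /F; case: ifP => // _ /setIP[].
  apply/astabP => _ /set2P[] ->; rewrite /= /aperm lex_permE.
    have := rA x; rewrite /F eqxx => /setIP[_ /astab1P /= rx].
    by rewrite [r x d0]rx [g x]gxy // !inE eqxx.
  have := rA y; rewrite /F eqxx orbT => /setIP[_ /astab1P /= ry].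
  by rewrite [r y d0]ry [g y]gxy // !inE eqxx orbT.
have := subset_leq_card sAD; rewrite card_in_imset; last first.
  by move=> [r g] [r' g'] _ _ /= /(lex_perm_inj d0)[-> ->].
by rewrite cardsX -AE mulnCA leq_mul2l mulnC => ->; rewrite orbT.
Qed.

End Lexicographic.

(** * Arbitrarily large graphs with local group [T] *)

Section BipartiteCover.
Variables (Omega : finType) (T : {group {perm Omega}}) (w : Omega) (n : nat).

Let Y := cover (bipartite Omega) n.
Let y0 : Y := ((true, w), 0%R).

Definition bicover := component y0.
Definition bicover_root : bicover := component_root y0.

Lemma bicover_connected (x y : bicover) : connect (ladj bicover) x y.
Proof. exact: component_connected. Qed.

Lemma card_bicover : 1 < #|Omega| -> n < #|bicover|.
Proof.
case/card_gt1P => i [j [_ _ ij]].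
have [w' ww'] : exists w', w != w'.
  by have [wi|] := eqVneq w i; [exists j; rewrite wi | exists i].
(* A 4-cycle through the root alternates sides over [w] and [w']. *)
by apply: (@card_component_cover _ (bipartite Omega) n (true, w) (false, w)
  (true, w') (false, w')); rewrite ?xpair_eqE //; exact: ladj_nb.
Qed.

Lemma bicover_trans (x : bicover) :
    [transitive T, on [set: Omega] | 'P] ->
  exists2 g, g \in ugroup bicover T & g bicover_root = x.
Proof.
move=> trT; case: x => -[[c i] x] y0x.
have [t tT ti] := atransP2 trT (in_setT w) (in_setT i).
(* The root is on side [true] with chain 0: swap sides iff [c] is false, then translate by [x]. *)
pose g := cover_perm (bip_perm (~~ c) t t) x.
have gU : g \in ugroup Y T by apply/cover_perm_ugroup/bip_perm_ugroup.
have gE : g y0 = ((c, i), x).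
  by rewrite permE /cover_fun /= coef_act0 add0r permE /bip_fun /= addbT negbK ti.
have gy0 : connect (ladj Y) y0 (g y0) by rewrite gE.
exists (component_perm y0 g); first exact: component_perm_ugroup.
by apply: val_inj; rewrite (component_permE gU).
Qed.

Definition bilift (s t : {perm Omega}) : {perm bicover} :=
  component_perm y0 (cover_perm (bip_perm false s t) 0%R).

Section Lift.
Variables s t : {perm Omega}.
Hypotheses (sT : s \in 'C_T[w | 'P]) (tT : t \in T).

Let g : {perm Y} := cover_perm (bip_perm false s t) 0%R.

Lemma bilift_root_subproof : g \in ugroup Y T /\ g y0 = y0.
Proof.
have [sT' /astab1P sw] := setIP sT.
split; first by apply/cover_perm_ugroup/bip_perm_ugroup.
by rewrite permE /cover_fun /= coef_act0 add0r permE /bip_fun /= [s w]sw.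
Qed.

Lemma val_bilift x : val (bilift s t x) = g (val x).
Proof.
have [gU gy0] := bilift_root_subproof.
by apply: (component_permE gU); rewrite gy0.
Qed.

Lemma bilift_ugroup : bilift s t \in ugroup bicover T.
Proof.
have [gU gy0] := bilift_root_subproof.
by apply: component_perm_ugroup; rewrite ?gy0.
Qed.

Lemma bilift_root : bilift s t bicover_root = bicover_root.
Proof. by apply: val_inj; rewrite val_bilift (proj2 bilift_root_subproof). Qed.

(** Membership in [ugroup] provides some local action; comparing base labels identifies it with the
    permutation of the opposite side. *)
Lemma bilift_nb (x : bicover) j :
  bilift s t (nb x j) =
  nb (bilift s t x) ((if (val x).1.1 then t else s) j).
Proof.
have [l _ lE] := ugroupP _ _ bilift_ugroup x; rewrite lE; congr nb.
have /(congr1 (fun z : bicover => (val z).1.2)) := lE j.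
rewrite val_bilift permE /cover_fun /= permE /bip_fun /= => <-.
by case: (val x).1.1.
Qed.

End Lift.

Lemma bicover_real t : t \in T ->
  exists2 g, g \in ugroup bicover T & g bicover_root = bicover_root /\
    forall j, g (nb bicover_root j) = nb bicover_root (t j).
Proof.
move=> tT; exists (bilift 1 t); first by rewrite bilift_ugroup ?group1.
split=> [|j]; first by rewrite bilift_root ?group1.
by rewrite bilift_nb ?bilift_root ?group1.
Qed.

(** When [s] and [t] fix [w], [bilift s t] fixes the arc. It determines [t] by its action around the
    root and [s] by its action around the other end. *)
Lemma card_bicover_arc_stab :
  #|'C_T[w | 'P]| ^ 2 <=
  #|'C_(ugroup bicover T)([set bicover_root; nb bicover_root w] | 'P)|.
Proof.
set S := 'C_T[w | 'P]; rewrite -mulnn -cardsX.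
have fixw s : s \in S -> s w = w by case/setIP=> _ /astab1P.
have sST s : s \in S -> s \in T by case/setIP.
rewrite -(card_in_imset (f := fun p => bilift p.1 p.2)).
  apply/subset_leq_card/subsetP => _ /imsetP[[s t] /setXP[/= sS tS] ->].
  have tT := sST t tS.
  rewrite inE bilift_ugroup //=; apply/astabP => _ /set2P[] ->.
    exact: bilift_root.
  by rewrite /= /aperm bilift_nb ?bilift_root //= ?fixw.
move=> [s t] [s' t'] /setXP[/= sS tS] /setXP[/= sS' tS'] /permP e.
have tT := sST t tS; have tT' := sST t' tS'.
congr pair; apply/permP => j; last first.
  have := e (nb bicover_root j).
  by rewrite !bilift_nb ?bilift_root // => /(@nb_inj _ _ bicover_root).
have := e (nb (nb bicover_root w) j).
rewrite !bilift_nb ?bilift_root //= ?fixw //.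
by move/(@nb_inj _ _ (nb bicover_root w)).
Qed.

End BipartiteCover.

(** * Growth of arc-stabilisers for the wreath product *)

Section Main.
Local Open Scope ring_scope.
Variables (K : realType) (Delta Omega : finType).
Variables (R : {group {perm Delta}}) (T : {group {perm Omega}}) (w : Omega).
Hypotheses (ntR : R :!=: 1%g) (ntT : T :!=: 1%g).
Hypotheses (trR : [transitive R, on [set: Delta] | 'P]).
Hypotheses (trT : [transitive T, on [set: Omega] | 'P]).

Lemma card_gt1_nontriv (A : finType) (H : {group {perm A}}) :
  H :!=: 1%g -> (1 < #|A|)%N.
Proof.
apply: contra_neqT; rewrite -leqNgt => /card_le1_eqP A1.
by apply/trivgP/subsetP => h _; rewrite inE; apply/eqP/permP => a; exact: A1.
Qed.

Lemma wreath_unrestrictive :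
  graph_unrestrictive (fun n : nat =>
    (#|'C_T[w | 'P]| ^ 2)%N%:R * (#|R|%:R `^ (n%:R / #|Delta|%:R))
      / (#|Delta| ^ 2)%N%:R : K) (wreath R T).
Proof.
move=> n; have [d0 _ _] := imsetP trR.
have m0 : (0 < #|Delta|)%N := ltnW (card_gt1_nontriv ntR).
pose X := bicover w n; pose x0 : X := bicover_root w n.
have conn := lex_connected (Delta := Delta) w (@bicover_connected _ w n).
exists (graph_of (X := lex Delta X) (d0, x0) conn).
exists (ugroup_group (lex Delta X) (wreath R T)); split.
- apply: lex_locally => // [x|t]; first exact: bicover_trans.
  exact: bicover_real.
- rewrite card_prod; apply: leq_trans (leq_pmull _ m0).
  exact/ltnW/card_bicover/(card_gt1_nontriv ntT).
exists (d0, x0), (d0, nb x0 w); split; first by rewrite /= ladj_lex ladj_nb.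
have m2 : (0 : K) < (#|Delta| ^ 2)%N%:R by rewrite ltr0n expn_gt0 m0.
(* The blow-up has [#|Delta| * #|X|] vertices, so the real exponent is the integer [#|X|] and the
   claim becomes one about naturals. *)
have mX : (#|Delta| * #|X|)%N%:R / #|Delta|%:R = #|X|%:R :> K.
  by rewrite natrM mulrAC divff ?mul1r // pnatr_eq0 -lt0n.
rewrite /= card_prod mX powR_mulrn // -natrX -natrM ler_pdivrMr // -natrM ler_nat.
have x0y : x0 != nb x0 w by rewrite eq_sym nb_irr.
rewrite [leqRHS]mulnC; apply: leq_trans (card_lex_arc_stab T d0 trR x0y).
by rewrite leq_mul2r card_bicover_arc_stab orbT.
Qed.

Lemma wreath_restrictive :
  graph_restrictive (fun n : nat => (#|Delta| * #|Omega|)%N%:R ^+ n : K)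
    (wreath R T).
Proof.
move=> X G locG u v _; rewrite -natrX ler_nat -card_prod.
apply: card_arc_stab locG; rewrite card_prod muln_gt0.
by rewrite (ltnW (card_gt1_nontriv ntR)) (ltnW (card_gt1_nontriv ntT)).
Qed.

Lemma wreath_unrestrictive_Exp :
  exists2 f : nat -> K, Exp f & graph_unrestrictive f (wreath R T).
Proof.
set m := #|Delta|; have m1 : (1 < m)%N := card_gt1_nontriv ntR.
have m0 : m%:R != 0 :> K by rewrite pnatr_eq0 -lt0n ltnW.
pose q : K := #|R|%:R; have q1 : 1 < q by rewrite ltr1n cardG_gt1.
have q0 : 0 <= q := ltW (lt_trans ltr01 q1).
(* Half of the exponent n / m absorbs the constant 1 / m ^ 2 once
   n >= 2 m ^ 3. *)
pose a : K := q `^ (2 * m%:R)^-1.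
have a0 : 0 <= a := powR_ge0 _ _.
have aX : a ^+ (2 * m) = q.
  rewrite -powR_mulrn // -powRrM natrM mulVf ?powRr1 //.
  by rewrite mulf_neq0 // pnatr_eq0.
have a1 : 1 < a.
  by rewrite -(@expr_gt1 _ (2 * m)) ?aX // muln_gt0 (ltnW m1).
exists (fun n => a ^+ n); first by exists a.
move=> n; have [X [G [locG nX [u [v [uv leG]]]]]] :=
  wreath_unrestrictive (n + 2 * m ^ 3)%N.
exists X, G; split=> //; first exact: leq_trans (leq_addr _ _) nX.
exists u, v; split=> //; apply: le_trans leG; rewrite -/m -/q.
have -> : q `^ (#|X|%:R / m%:R) = a ^+ #|X| * a ^+ #|X|.
  rewrite -exprD -powR_mulrn // -powRrM; congr (_ `^ _).
  by rewrite addnn -mul2n natrM invfM mulrACA mulVf ?pnatr_eq0 // mul1r mulrC.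
(* With [q >= 2]: m^2 <= 2^(m^2) <= q^(m^2) = a^(2m^3), and [#|X|] is at least 2m^3. *)
have mX : (m ^ 2)%N%:R <= a ^+ #|X|.
  apply: (@le_trans _ _ (q ^+ (m ^ 2))).
    apply: (@le_trans _ _ (2 ^ (m ^ 2))%N%:R).
      by rewrite ler_nat ltnW // ltn_expl.
    by rewrite natrX; apply: lerXn2r; rewrite ?nnegrE // ler_nat cardG_gt1.
  rewrite -aX -exprM ler_weXn2l ?ltW //.
  by apply: leq_trans nX; rewrite -mulnA -expnS leq_addl.
rewrite ler_pdivlMr ?ltr0n ?expn_gt0 ?(ltnW m1) // mulrA mulrC.
rewrite ler_wpM2r ?exprn_ge0 // (le_trans mX) // ler_peMl ?exprn_ge0 //.
by rewrite ler1n expn_gt0 cardG_gt0.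
Qed.

End Main.

Theorem theorem3p2 (K : realType) (Delta Omega : finType)
    (R : {group {perm Delta}}) (T : {group {perm Omega}}) (w : Omega)
    (ntR : R :!=: 1) (ntT : T :!=: 1)
    (trR : [transitive R, on [set: Delta] | 'P])
    (trT : [transitive T, on [set: Omega] | 'P]) :
  let m := #|Delta| in
  let f := fun n : nat =>
    ((#|'C_T[w | 'P]| ^ 2)%N%:R * (#|R|%:R `^ (n%:R / m%:R)) / (m ^ 2)%N%:R
      : K)%R in
  graph_unrestrictive f (wreath R T) /\ has_graph_type (@Exp K) (wreath R T).
Proof.
move=> m f; split; first exact: wreath_unrestrictive.
split; last exact: (wreath_unrestrictive_Exp K w).
(* The base is the degree of the wreath product, that is, the valency. *)
exists (fun n => (m * #|Omega|)%N%:R ^+ n)%R; last exact: wreath_restrictive.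
exists (m * #|Omega|)%N%:R%R => //; rewrite ltr1n.
rewrite (leq_trans (card_gt1_nontriv ntR)) // leq_pmulr //.
exact/ltnW/(card_gt1_nontriv ntT).
Qed.
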